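(* Consider the problem $\min_{x\in\mathbb{R}^n} f(x)=\sum_{i=1}^N f_i(x_i,\sigma(x))$, $\sigma(x)=\frac1N\sum_{i=1}^N\phi_i(x_i)$, over a network with communication graph $\mathcal{G}$ and communication matrix $A$, with the graph assumptions (G1)–(G2) and the function assumptions (F1)–(F3) given in the context, with constants $\mu, L_1, L_2, L_3$, and let $\rho:=\|A-J\|$. Put $$L_\mu:=\mu+L_1+L_1L_3,\qquad L_0:=L_1+L_2+L_2L_3,\qquad \alpha_s:=\frac{\mu(1-\rho)^2}{L_3L_\mu[(1-\rho)L_0+2L_2L_3]}.$$ If the stepsize satisfies $$0<\alpha<\min\Big\{\frac{1}{L_1},\alpha_s\Big\},$$ then, for arbitrary initial $x_{i,0}\in\mathbb{R}^{n_i}$, $i\in[N]$, the sequence $x_k=col(x_{1,k},\ldots,x_{N,k})$ generated by the distributed gradient tracking (DGT) algorithm described in the context converges to the optimizer $x^*$ of the problem at a linear rate, i.e. there exist constants $C\ge 0$ and $q\in(0,1)$ such that $\|x_k-x^*\|\le C q^k$ for all $k\ge 0$.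
   Context: Notation. $[N]=\{1,\ldots,N\}$; $col(z_1,\ldots,z_N)$ is the column vector stacking $z_1,\ldots,z_N$; $\|\cdot\|$ is the Euclidean norm for vectors and the induced (spectral) norm for matrices; $\mathbf{1}_N$ is the all-ones vector in $\mathbb{R}^N$; $J:=\frac1N\mathbf{1}_N\mathbf{1}_N^\top\in\mathbb{R}^{N\times N}$; $\otimes$ is the Kronecker product. Graph. $\mathcal{G}=(\mathcal{V},\mathcal{E})$ is a directed graph with $\mathcal{V}=\{1,\ldots,N\}$ and $\mathcal{E}\subset\mathcal{V}\times\mathcal{V}$; its communication matrix $A=(a_{ij})\in\mathbb{R}^{N\times N}$ satisfies $a_{ij}>0$ if $(j,i)\in\mathcal{E}$ and $a_{ij}=0$ otherwise. Assumptions: (G1) $\mathcal{G}$ is strongly connected; (G2) $A$ is doubly stochastic: $\sum_{j=1}^N a_{ij}=1$ for all $i$ and $\sum_{i=1}^N a_{ij}=1$ for all $j$. Problem data. $x=col(x_1,\ldots,x_N)\in\mathbb{R}^n$ with $x_i\in\mathbb{R}^{n_i}$ and $n=\sum_{i=1}^N n_i$; $\phi_i:\mathbb{R}^{n_i}\to\mathbb{R}^d$; $f_i:\mathbb{R}^{n_i}\times\mathbb{R}^d\to\mathbb{R}$, $(x_i,\sigma)\mapsto f_i(x_i,\sigma)$, is differentiable, with partial gradients $\nabla_1 f_i\in\mathbb{R}^{n_i}$ (with respect to $x_i$) and $\nabla_2 f_i\in\mathbb{R}^d$ (with respect to $\sigma$). For a differentiable vector-valued $g=col(g_1,\ldots,g_m)$,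 $\nabla g=(\nabla g_1,\ldots,\nabla g_m)$, the matrix whose columns are the gradients of the components; thus $\nabla\phi_i(x_i)\in\mathbb{R}^{n_i\times d}$. Put $\phi(x):=col(\phi_1(x_1),\ldots,\phi_N(x_N))$, so $\nabla\phi(x)\in\mathbb{R}^{n\times Nd}$ is block diagonal with blocks $\nabla\phi_i(x_i)$. For $y=col(y_1,\ldots,y_N)\in\mathbb{R}^{Nd}$ with $y_i\in\mathbb{R}^d$, put $\nabla_1 f(x,y):=col(\nabla_1 f_1(x_1,y_1),\ldots,\nabla_1 f_N(x_N,y_N))$ and $\nabla_2 f(x,y):=col(\nabla_2 f_1(x_1,y_1),\ldots,\nabla_2 f_N(x_N,y_N))$. Function assumptions. (F1) The global function $f(x)=\sum_i f_i(x_i,\sigma(x))$ is differentiable, $\mu$-strongly convex with $\mu>0$ (i.e. $f(x)\ge f(x')+\nabla f(x')^\top(x-x')+\frac{\mu}{2}\|x-x'\|^2$ for all $x,x'$), and $L_1$-smooth: $\|\nabla f(x)-\nabla f(x')\|\le L_1\|x-x'\|$ for all $x,x'\in\mathbb{R}^n$. Also the map $G(x,y):=\nabla_1 f(x,y)+\nabla\phi(x)\big(\mathbf{1}_N\otimes\frac1N\sum_{i=1}^N\nabla_2 f_i(x_i,y_i)\big)$ is $L_1$-Lipschitz: $\|G(x,y)-G(x',y')\|\le L_1(\|x-x'\|+\|y-y'\|)$ for all $x,x'\in\mathbb{R}^n$, $y,y'\in\mathbb{R}^{Nd}$. (F2) $\|\nabla_2 f(x,y)-\nabla_2 f(x',y')\|\le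 L_2(\|x-x'\|+\|y-y'\|)$ for all $x,x'\in\mathbb{R}^n$, $y,y'\in\mathbb{R}^{Nd}$. (F3) All $\phi_i$ are differentiable and there is a constant $L_3>0$ with $\|\nabla\phi_i(x_i)\|\le L_3$ for all $x_i\in\mathbb{R}^{n_i}$ and $i\in[N]$. (Convexity of the individual $f_i$ is not assumed.) DGT algorithm with stepsize $\alpha>0$. Initialization: $x_{i,0}\in\mathbb{R}^{n_i}$ arbitrary, $\sigma_{i,0}=\phi_i(x_{i,0})$, $y_{i,0}=\nabla_2 f_i(x_{i,0},\sigma_{i,0})$ for all $i\in[N]$. For $k\ge0$ and each $i\in[N]$: $$x_{i,k+1}=x_{i,k}-\alpha[\nabla_1 f_i(x_{i,k},\sigma_{i,k})+\nabla\phi_i(x_{i,k})y_{i,k}],$$ $$\sigma_{i,k+1}=\sum_{j=1}^N a_{ij}\sigma_{j,k}+\phi_i(x_{i,k+1})-\phi_i(x_{i,k}),$$ $$y_{i,k+1}=\sum_{j=1}^N a_{ij}y_{j,k}+\nabla_2 f_i(x_{i,k+1},\sigma_{i,k+1})-\nabla_2 f_i(x_{i,k},\sigma_{i,k}).$$ *)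

(* Defs.v *)
From HB Require Import structures.
From mathcomp Require Import all_boot all_order all_algebra.
From mathcomp Require Import all_classical all_reals all_analysis.

Set Implicit Arguments.
Unset Strict Implicit.
Unset Printing Implicit Defensive.

Import Order.TTheory GRing.Theory Num.Theory.
Import numFieldNormedType.Exports.

Local Open Scope classical_set_scope.
Local Open Scope ring_scope.

Section Euclidean.
Context {R : realType}.

(* The library norm `|v| on matrices is the max-norm, hence a separate
   Euclidean norm. Being equivalent in finite dimension, the two norms give
   the same notion of differentiability. *)
Definition enorm m (v : 'cV[R]_m) : R := Num.sqrt (\sum_i v i 0 ^+ 2).

Definition opnorm m p (M : 'M[R]_(m, p)) : R :=
  sup [set enorm (M *m v) | v in [set v : 'cV[R]_p | enorm v <= 1]].

Definition grad m (g : 'cV[R]_m -> R) (x : 'cV[R]_m) : 'cV[R]_m :=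
  \col_i 'D_(delta_mx i 0) g x.

(* The columns are the gradients of the components: the transpose of the
   usual Jacobian matrix. *)
Definition gradmx m p (g : 'cV[R]_m -> 'cV[R]_p) (x : 'cV[R]_m) :
    'M[R]_(m, p) :=
  \matrix_(i, j) grad (fun z => g z j 0) x i 0.

Definition strongly_convex m (mu : R) (F : 'cV[R]_m -> R) : Prop :=
  forall x x' : 'cV[R]_m,
    F x >= F x' + ((grad F x')^T *m (x - x')) 0 0
           + mu / 2 * enorm (x - x') ^+ 2.

Definition smooth m (L : R) (F : 'cV[R]_m -> R) : Prop :=
  forall x x' : 'cV[R]_m, enorm (grad F x - grad F x') <= L * enorm (x - x').

Definition minimizer m (F : 'cV[R]_m -> R) (x : 'cV[R]_m) : Prop :=
  forall z : 'cV[R]_m, F x <= F z.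

End Euclidean.

Section Network.
Context {R : realType} {N : nat}.

Definition strongly_connected (E : rel 'I_N) : Prop :=
  forall i j : 'I_N, connect E i j.

(* [E j i] is the edge (j, i), along which agent i receives from agent j. *)
Definition communication_matrix (E : rel 'I_N) (A : 'M[R]_N) : Prop :=
  forall i j : 'I_N, (E j i -> 0 < A i j) /\ (~~ E j i -> A i j = 0).

Definition doubly_stochastic (A : 'M[R]_N) : Prop :=
  (forall i, \sum_j A i j = 1) /\ (forall j, \sum_i A i j = 1).

Definition avgmx : 'M[R]_N :=
  N%:R^-1 *: ((const_mx 1 : 'cV[R]_N) *m (const_mx 1 : 'cV[R]_N)^T).

End Network.

Section Aggregative.
Context {R : realType} {N : nat} {n : 'I_N -> nat} {d : nat}.

(* R^(n_1 + ... + n_N) and R^(N d), in the form expected by [\mxcol] and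
   [submxcol]: the i-th block of x is [submxcol x i]. *)
Definition stackX := 'cV[R]_(\sum_(i < N) n i).
Definition stackY := 'cV[R]_(\sum_(i < N) (fun=> d) i).

Variables (phi : forall i, 'cV[R]_(n i) -> 'cV[R]_d).
Variables (f : forall i, 'cV[R]_(n i) -> 'cV[R]_d -> R).

Definition grad1 i (u : 'cV[R]_(n i)) (s : 'cV[R]_d) : 'cV[R]_(n i) :=
  grad (fun u' => f u' s) u.

Definition grad2 i (u : 'cV[R]_(n i)) (s : 'cV[R]_d) : 'cV[R]_d :=
  grad (fun s' => f u s') s.

Definition sigma (x : stackX) : 'cV[R]_d :=
  N%:R^-1 *: \sum_i phi (submxcol x i).

Definition global (x : stackX) : R := \sum_i f (submxcol x i) (sigma x).

Definition stack_phi (x : stackX) : stackY := \mxcol_i phi (submxcol x i).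

Definition stack_grad1 (x : stackX) (y : stackY) : stackX :=
  \mxcol_i grad1 (submxcol x i) (submxcol y i).

Definition stack_grad2 (x : stackX) (y : stackY) : stackY :=
  \mxcol_i grad2 (submxcol x i) (submxcol y i).

(* [\mxcol_(i < N) v] is the Kronecker product of the all-ones vector of R^N
   with v. *)
Definition Gmap (x : stackX) (y : stackY) : stackX :=
  stack_grad1 x y +
  gradmx stack_phi x *m
    (\mxcol_(i < N) (N%:R^-1 *: \sum_j grad2 (submxcol x j) (submxcol y j))
      : stackY).

Record dgt_state := DgtState {
  dgt_x : forall i, 'cV[R]_(n i);
  dgt_sigma : 'I_N -> 'cV[R]_d;
  dgt_y : 'I_N -> 'cV[R]_d
}.

Definition dgt_init (x0 : forall i, 'cV[R]_(n i)) : dgt_state :=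
  {| dgt_x := x0;
     dgt_sigma := fun i => phi (x0 i);
     dgt_y := fun i => grad2 (x0 i) (phi (x0 i)) |}.

Definition dgt_step (A : 'M[R]_N) (alpha : R) (st : dgt_state) : dgt_state :=
  let: DgtState x s y := st in
  let x' := fun i =>
    x i - alpha *: (grad1 (x i) (s i) + gradmx (@phi i) (x i) *m y i) in
  let s' := fun i =>
    (\sum_j A i j *: s j) + phi (x' i) - phi (x i) in
  let y' := fun i =>
    (\sum_j A i j *: y j) + grad2 (x' i) (s' i) - grad2 (x i) (s i) in
  DgtState x' s' y'.

Definition dgt (A : 'M[R]_N) (alpha : R) (x0 : forall i, 'cV[R]_(n i))
    (k : nat) : dgt_state :=
  iter k (dgt_step A alpha) (dgt_init x0).

Definition dgt_iterate (A : 'M[R]_N) (alpha : R)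
    (x0 : forall i, 'cV[R]_(n i)) (k : nat) : stackX :=
  \mxcol_i dgt_x (dgt A alpha x0 k) i.

End Aggregative.

Arguments stackX {R N} n.
Arguments stackY R N d : clear implicits.

(* Main.v *)
Require Import Defs.
From HB Require Import structures.
From mathcomp Require Import all_boot all_order all_algebra.
From mathcomp Require Import ring lra.
From mathcomp Require Import all_classical all_reals all_analysis.

Set Implicit Arguments.
Unset Strict Implicit.
Unset Printing Implicit Defensive.

Import Order.TTheory GRing.Theory Num.Theory.
Import numFieldNormedType.Exports.
Local Open Scope ring_scope.

(** The proof compares the DGT iteration with exact gradient descent.

    Write [global phi f] as F. Since [A] is doubly stochastic, mixing preserves
    averages, so the averages of the agents' estimates of sigma and of the second
    partial gradients are always exact ([tracking]). By the chain rule
    ([grad_global]) the direction followed by the agents is then the gradient of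
    F up to an error controlled by the disagreement s of the sigma-estimates and
    the disagreement t of the gradient estimates.

    For F itself, the gradient step of size alpha < 1 / L1 contracts distances by
    1 - alpha mu ([gradient_step_contraction]). This follows from cocoercivity
    of the gradient of F - (mu / 2) |.|^2 and is derived from the two defining
    inequalities of strong convexity and smoothness alone. It also provides the
    minimizer, as the fixed point of this contraction ([minimizer_exists]).

    Disagreements are contracted by rho := |A - avgmx| at each mixing
    ([enorm_dev_mix]) and fed by the displacement delta of the iterates, because
    phi is L3-Lipschitz ([stack_phi_lipschitz]) and the second partial gradients
    are L2-Lipschitz. With e the distance to the minimizer this yields
    - delta <= alpha (L1 e + L1 s + L3 t),
    - e' <= (1 - alpha mu) e + alpha (L1 s + L3 t),
    - s' <= rho s + L3 delta,
    - t' <= rho t + L2 (delta + 2 s + L3 delta).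

    The condition alpha < alpha_s guarantees weights b, c > 0 for which
    e + b s + c t decreases geometrically ([lyapunov_weights],
    [coupled_recursion_rate]). That rho < 1 is itself a consequence of
    0 < alpha < alpha_s, since rho <= 1 ([opnorm_stochastic]) and alpha_s
    vanishes for rho = 1. *)

(** * Inner product, Euclidean norm and operator norm *)

Section Euclid.
Context {R : realType}.

Definition dot m (u v : 'cV[R]_m) : R := (u^T *m v) 0 0.

Lemma dotE m (u v : 'cV[R]_m) : dot u v = \sum_i u i 0 * v i 0.
Proof. by rewrite /dot mxE; apply: eq_bigr => i _; rewrite mxE. Qed.

Lemma dotC m (u v : 'cV[R]_m) : dot u v = dot v u.
Proof. by rewrite !dotE; apply: eq_bigr => i _; rewrite mulrC. Qed.

Lemma dotDr m (u v w : 'cV[R]_m) : dot u (v + w) = dot u v + dot u w.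
Proof. by rewrite /dot mulmxDr mxE. Qed.

Lemma dotDl m (u v w : 'cV[R]_m) : dot (v + w) u = dot v u + dot w u.
Proof. by rewrite dotC dotDr !(dotC u). Qed.

Lemma dotZr m (u v : 'cV[R]_m) a : dot u (a *: v) = a * dot u v.
Proof. by rewrite /dot -scalemxAr mxE. Qed.

Lemma dotZl m (u v : 'cV[R]_m) a : dot (a *: u) v = a * dot u v.
Proof. by rewrite dotC dotZr dotC. Qed.

Lemma dotNr m (u v : 'cV[R]_m) : dot u (- v) = - dot u v.
Proof. by rewrite -scaleN1r dotZr mulN1r. Qed.

Lemma dotNl m (u v : 'cV[R]_m) : dot (- u) v = - dot u v.
Proof. by rewrite dotC dotNr dotC. Qed.

Lemma dot_sumr m (I : finType) (u : 'cV[R]_m) (v : I -> 'cV[R]_m) :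
  dot u (\sum_i v i) = \sum_i dot u (v i).
Proof. by rewrite /dot mulmx_sumr summxE. Qed.

Lemma dot_mull m p (M : 'M[R]_(m, p)) u v : dot (M *m u) v = dot u (M^T *m v).
Proof. by rewrite /dot trmx_mul mulmxA. Qed.

Lemma dot_ge0 m (u : 'cV[R]_m) : 0 <= dot u u.
Proof. by rewrite dotE sumr_ge0// => i _; rewrite -expr2 sqr_ge0. Qed.

Lemma dot_eq0 m (u : 'cV[R]_m) : dot u u = 0 -> u = 0.
Proof.
rewrite dotE => /eqP; rewrite psumr_eq0; last first.
  by move=> i _; rewrite -expr2 sqr_ge0.
move=> /allP u0; apply/colP => i; rewrite mxE.
by have := u0 i (mem_index_enum i); rewrite /= mulf_eq0 orbb => /eqP.
Qed.

(** Equalities between stacked vectors are proved by testing them against every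
    vector, which turns block computations into sums of inner products. *)
Lemma dot_inj m (u v : 'cV[R]_m) : (forall w, dot u w = dot v w) -> u = v.
Proof.
move=> uv; apply/subr0_eq/dot_eq0.
by rewrite dotDl dotNl uv subrr.
Qed.

Lemma sqr_enorm m (u : 'cV[R]_m) : enorm u ^+ 2 = dot u u.
Proof.
rewrite /enorm sqr_sqrtr; last by rewrite sumr_ge0// => i _; rewrite sqr_ge0.
by rewrite dotE; apply: eq_bigr => i _; rewrite expr2.
Qed.

Lemma enorm_ge0 m (u : 'cV[R]_m) : 0 <= enorm u.
Proof. exact: sqrtr_ge0. Qed.

Lemma enorm0 m : enorm (0 : 'cV[R]_m) = 0.
Proof. by apply/eqP; rewrite -sqrf_eq0 sqr_enorm /dot mulmx0 mxE. Qed.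

Lemma enorm_eq0 m (u : 'cV[R]_m) : enorm u = 0 -> u = 0.
Proof. by move=> u0; apply: dot_eq0; rewrite -sqr_enorm u0 expr0n. Qed.

Lemma enormZ m a (u : 'cV[R]_m) : enorm (a *: u) = `|a| * enorm u.
Proof.
apply/eqP; rewrite -(eqrXn2 (n := 2))// ?enorm_ge0//; last first.
  by rewrite mulr_ge0// enorm_ge0.
by rewrite exprMn !sqr_enorm dotZl dotZr real_normK ?num_real// mulrA expr2.
Qed.

Lemma enormN m (u : 'cV[R]_m) : enorm (- u) = enorm u.
Proof. by rewrite -scaleN1r enormZ normrN1 mul1r. Qed.

Lemma enormBC m (u v : 'cV[R]_m) : enorm (u - v) = enorm (v - u).
Proof. by rewrite -enormN opprB. Qed.

Lemma le_enorm m p (u : 'cV[R]_m) (v : 'cV[R]_p) a :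
  0 <= a -> dot u u <= a ^+ 2 * dot v v -> enorm u <= a * enorm v.
Proof.
move=> a0 uv; rewrite -(ler_pXn2r (n := 2))// ?nnegrE ?enorm_ge0//; last first.
  by rewrite mulr_ge0// enorm_ge0.
by rewrite exprMn !sqr_enorm.
Qed.

Lemma dot_le m (u v : 'cV[R]_m) : dot u v <= enorm u * enorm v.
Proof.
have [v0|v0] := eqVneq (enorm v) 0.
  by rewrite v0 mulr0 (enorm_eq0 v0) /dot mulmx0 mxE.
have vp : 0 < enorm v by rewrite lt_def v0 enorm_ge0.
(* up to the factor |v|^2, the vector below is the component of u orthogonal
   to v; its squared norm is |v|^2 (|u|^2 |v|^2 - <u, v>^2) *)
have := dot_ge0 (enorm v ^+ 2 *: u - dot u v *: v).
rewrite !(dotDl, dotDr, dotZl, dotZr, dotNl, dotNr) (dotC v u) -!sqr_enorm.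
set a := enorm u; set b := enorm v in vp *; set c := dot u v => h.
have ab : 0 <= a * b by rewrite mulr_ge0 ?enorm_ge0.
rewrite leNgt; apply/negP => cab.
have : 0 <= b ^+ 2 * ((a * b) ^+ 2 - c ^+ 2) by nra.
rewrite pmulr_rge0 ?exprn_gt0// subr_ge0 ler_pXn2r ?nnegrE//; last by lra.
by rewrite leNgt cab.
Qed.

Lemma enormD m (u v : 'cV[R]_m) : enorm (u + v) <= enorm u + enorm v.
Proof.
rewrite -(ler_pXn2r (n := 2))// ?nnegrE ?addr_ge0 ?enorm_ge0//.
rewrite sqr_enorm sqrrD !(dotDl, dotDr) (dotC v u) -!sqr_enorm.
by have := dot_le u v; nra.
Qed.

Lemma enormB m (u v : 'cV[R]_m) : enorm (u - v) <= enorm u + enorm v.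
Proof. by rewrite -(enormN v) enormD. Qed.

Lemma coord_le_enorm m (u : 'cV[R]_m) i : `|u i 0| <= enorm u.
Proof.
rewrite -(ler_pXn2r (n := 2))// ?nnegrE ?enorm_ge0//.
rewrite sqr_enorm dotE (bigD1 i)//= real_normK ?num_real// -expr2 lerDl.
by rewrite sumr_ge0// => j _; rewrite -expr2 sqr_ge0.
Qed.

Lemma enorm_le_sum m (u : 'cV[R]_m) : enorm u <= \sum_i `|u i 0|.
Proof.
have s0 (P : pred 'I_m) : 0 <= \sum_(i | P i) `|u i 0| by exact: sumr_ge0.
rewrite -(ler_pXn2r (n := 2))// ?nnegrE ?enorm_ge0// sqr_enorm dotE.
rewrite [leRHS]expr2 mulr_suml ler_sum// => i _.
rewrite -expr2 -real_normK ?num_real// expr2 ler_wpM2l//.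
by rewrite (bigD1 i)//= lerDl.
Qed.

(** [sup] is only meaningful on bounded sets; here a bound is the sum of the
    absolute values of the entries of [M]. *)
Lemma opnorm_has_ub m p (M : 'M[R]_(m, p)) :
  has_ubound
    [set enorm (M *m v) | v in [set v : 'cV[R]_p | enorm v <= 1]]%classic.
Proof.
exists (\sum_i \sum_j `|M i j|) => _ [v /= v1 <-].
apply: le_trans (enorm_le_sum _) _; apply: ler_sum => i _.
rewrite mxE (le_trans (ler_norm_sum _ _ _))//; apply: ler_sum => j _.
by rewrite normrM ler_piMr// (le_trans (coord_le_enorm _ _)).
Qed.

Lemma opnorm_ge0 m p (M : 'M[R]_(m, p)) : 0 <= opnorm M.
Proof.
apply: (@ub_le_sup _ _ (opnorm_has_ub M)); exists 0 => /=.
  by rewrite enorm0 ler01.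
by rewrite mulmx0 enorm0.
Qed.

Lemma opnormP m p (M : 'M[R]_(m, p)) v : enorm (M *m v) <= opnorm M * enorm v.
Proof.
have [v0|v0] := eqVneq (enorm v) 0.
  by rewrite (enorm_eq0 v0) mulmx0 !enorm0 mulr0.
have vp : 0 < enorm v by rewrite lt_def v0 enorm_ge0.
have : enorm (M *m ((enorm v)^-1 *: v)) <= opnorm M.
  apply: (@ub_le_sup _ _ (opnorm_has_ub M)); exists ((enorm v)^-1 *: v) => //=.
  by rewrite enormZ gtr0_norm ?invr_gt0// mulVf.
by rewrite -scalemxAr enormZ gtr0_norm ?invr_gt0// ler_pdivrMl// mulrC.
Qed.

Lemma opnorm_le m p (M : 'M[R]_(m, p)) a :
  0 <= a -> (forall v, enorm (M *m v) <= a * enorm v) -> opnorm M <= a.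
Proof.
move=> a0 Ma; apply: ge_sup.
  by exists (enorm (M *m 0)), 0; rewrite //= enorm0 ler01.
by move=> _ [v /= v1 <-]; apply: le_trans (Ma v) _; rewrite ler_piMr.
Qed.

End Euclid.

Section Blocks.
Context {R : realType} {N : nat}.

Lemma dot_mxcol (m : 'I_N -> nat) (u v : forall i, 'cV[R]_(m i)) :
  dot (\mxcol_i u i) (\mxcol_i v i) = \sum_i dot (u i) (v i).
Proof. by rewrite /dot tr_mxcol mul_mxrow_mxcol summxE. Qed.

Lemma dot_submxcol (m : 'I_N -> nat) (u v : 'cV[R]_(\sum_i m i)) :
  dot u v = \sum_i dot (submxcol u i) (submxcol v i).
Proof. by rewrite -{1}(submxcolK u) -{1}(submxcolK v) dot_mxcol. Qed.

Lemma submxcolZ (m : 'I_N -> nat) a (x : 'cV[R]_(\sum_i m i)) i :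
  submxcol (a *: x) i = a *: submxcol x i.
Proof. by apply/colP => j; rewrite !mxE. Qed.

Lemma le_enorm_blocks (m p : 'I_N -> nat) (u : 'cV[R]_(\sum_i m i))
    (v : 'cV[R]_(\sum_i p i)) a :
  0 <= a ->
  (forall i, enorm (submxcol u i) <= a * enorm (submxcol v i)) ->
  enorm u <= a * enorm v.
Proof.
move=> a0 uv; apply: le_enorm => //.
rewrite !dot_submxcol mulr_sumr ler_sum// => i _.
by rewrite -!sqr_enorm -exprMn ler_pXn2r// ?nnegrE ?mulr_ge0 ?enorm_ge0.
Qed.

End Blocks.

(** * Gradients, differentials and the mean value inequality *)

Section Calculus.
Context {R : realType}.

Lemma cV_sum_delta m (v : 'cV[R]_m) : v = \sum_i v i 0 *: delta_mx i 0.
Proof.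
by rewrite {1}[v]matrix_sum_delta; apply: eq_bigr => i _; rewrite big_ord1.
Qed.

(** Linearity suffices because R^m is finite-dimensional: the map is a finite
    sum of coordinate functions with vector coefficients, hence continuous. *)
Lemma linear_cV_is_diff m (V : normedModType R) (h : 'cV[R]_m -> V) x :
  linear h -> is_diff x h h.
Proof.
move=> hlin; pose hM := GRing.isLinear.Build _ _ _ _ _ hlin.
pose hL : {linear 'cV[R]_m -> V} := HB.pack h hM.
suff hc : continuous h.
  apply: DiffDef; first exact: (@linear_differentiable _ _ _ hL x hc).
  exact: (@diff_lin _ _ _ hL x hc).
have -> : h = \sum_(i < m) (fun v : 'cV[R]_m => v i 0 *: h (delta_mx i 0)).
  apply/funext => v; rewrite fct_sumE [in LHS](cV_sum_delta v).
  rewrite -[h]/(hL : _ -> _) linear_sum.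
  by apply: eq_bigr => i _; rewrite linearZ.
move=> v; apply/differentiable_continuous/differentiable_sum => i.
exact/differentiableZl/differentiable_coord.
Qed.

Lemma dot_linear m (w : 'cV[R]_m) : linear (dot w).
Proof. by move=> a u v; rewrite dotDr dotZr. Qed.

Lemma submxcol_linear N (n : 'I_N -> nat) i :
  linear (fun x : 'cV[R]_(\sum_i n i) => submxcol x i).
Proof. by move=> a u v; rewrite submxcolD submxcolZ. Qed.

Lemma diff_grad m (g : 'cV[R]_m -> R) x v :
  differentiable g x -> 'd g x v = dot (grad g x) v.
Proof.
move=> dg; rewrite {1}(cV_sum_delta v) linear_sum dotE; apply: eq_bigr => i _.
by rewrite linearZ mxE deriveE// mulrC.
Qed.

Lemma grad_unique m (g : 'cV[R]_m -> R) x u :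
  (forall v, 'D_v g x = dot u v) -> grad g x = u.
Proof.
move=> gu; apply/colP => i; rewrite mxE gu dotE (bigD1 i)//= mxE !eqxx mulr1.
rewrite big1 ?addr0// => j ji; rewrite mxE (negbTE ji) mulr0//.
Qed.

Lemma tr_gradmx_mulE m p (g : 'cV[R]_m -> 'cV[R]_p) x v j :
  differentiable (fun z => g z j 0) x ->
  ((gradmx g x)^T *m v) j 0 = 'd (fun z => g z j 0) x v.
Proof.
move=> dg; rewrite diff_grad// dotE !mxE; apply: eq_bigr => i _.
by rewrite !mxE.
Qed.

Lemma is_diff_coord m p (g : 'cV[R]_m -> 'cV[R]_p) x j :
  differentiable g x ->
  is_diff x (fun z => g z j 0) (fun v => 'd g x v j 0).
Proof.
move=> dg; have gd : is_diff x g ('d g x) by exact: differentiableP.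
have cd : is_diff (g x) (fun z : 'cV[R]_p => z j 0) (fun z => z j 0).
  by apply: linear_cV_is_diff => a u v; rewrite !mxE.
exact: (@is_diff_comp _ _ _ _ g _ _ _ x gd cd).
Qed.

Lemma tr_gradmx_mul m p (g : 'cV[R]_m -> 'cV[R]_p) x v :
  differentiable g x -> (gradmx g x)^T *m v = 'd g x v.
Proof.
move=> dg; apply/colP => j; have dj := is_diff_coord j dg.
by rewrite tr_gradmx_mulE ?diff_val//; exact: ex_diff.
Qed.

(** The mean value theorem fails for vector-valued maps, so it is applied to the
    scalar function t |-> <w, g (v + t (u - v))> with w := g u - g v: it gives
    |w|^2 = <gradmx g c *m w, u - v> for some point c of the segment. *)
Lemma gradmx_lipschitz m p (g : 'cV[R]_m -> 'cV[R]_p) L :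
  (forall u, differentiable g u) -> (forall u, opnorm (gradmx g u) <= L) ->
  forall u v, enorm (g u - g v) <= L * enorm (u - v).
Proof.
move=> dg gL u v; set w := g u - g v.
pose line (t : R) := t *: (u - v) + v.
pose h := dot w \o (g \o line).
have dline t : is_diff t line (fun s => s *: (u - v)).
  have := @is_diffD _ _ _ _ _ _ _ t (is_diff_scalel t (u - v)) (is_diff_cst v t).
  by rewrite [X in is_diff _ _ X -> _](_ : _ = fun s => s *: (u - v))//;
    apply/funext => s /=; rewrite fctE addr0.
have dh t : is_diff t h (fun s => dot w ('d g (line t) (s *: (u - v)))).
  have gl : is_diff (line t) g ('d g (line t)) by exact: differentiableP.
  have := is_diff_comp (is_diff_comp (dline t) gl)
    (linear_cV_is_diff (g (line t)) (@dot_linear _ w)).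
  by [].
have h1 (t : R) : is_derive t 1 h (dot w ('d g (line t) (u - v))).
  apply: DeriveDef; first exact/diff_derivable/ex_diff.
  by rewrite deriveE ?diff_val ?scale1r//; exact: ex_diff.
have hc : {within `[0, 1], continuous h}%classic.
  by apply: continuous_subspaceT => t; apply/differentiable_continuous/ex_diff.
have [c _] := MVT_segment ler01 (fun t _ => h1 t) hc.
rewrite /h /= /line scale1r scale0r subrK add0r subr0 mulr1 -tr_gradmx_mul//.
rewrite -dotNr -dotDr -/w -dot_mull -sqr_enorm.
have [w0 _|w0 e] := eqVneq (enorm w) 0.
  by rewrite w0 mulr_ge0 ?enorm_ge0// (le_trans (opnorm_ge0 _) (gL u)).
have wp : 0 < enorm w by rewrite lt_def w0 enorm_ge0.
rewrite -(ler_pM2l wp) -expr2 e (le_trans (dot_le _ _))// mulrCA mulrA.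
rewrite ler_wpM2r ?enorm_ge0// (le_trans (opnormP _ _))//.
by rewrite ler_wpM2r ?enorm_ge0.
Qed.

End Calculus.

(** * The gradient of the aggregative objective *)

Section AggregativeCalculus.
Context {R : realType} {N : nat} {n : 'I_N -> nat} {d : nat}.
Variables (phi : forall i, 'cV[R]_(n i) -> 'cV[R]_d).
Variables (f : forall i, 'cV[R]_(n i) -> 'cV[R]_d -> R).
Hypothesis f_diff : forall i (u : 'cV[R]_(n i)) (s : 'cV[R]_d),
  differentiable (fun p : 'cV[R]_(n i) * 'cV[R]_d => f p.1 p.2) (u, s).
Hypothesis phi_diff : forall i (u : 'cV[R]_(n i)), differentiable (@phi i) u.

Lemma phi_block_is_diff i (x : stackX n) :
  is_diff x (fun z : stackX n => phi (submxcol z i))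
            (fun v => (gradmx (@phi i) (submxcol x i))^T *m submxcol v i).
Proof.
have pd : is_diff (submxcol x i) (@phi i) ('d (@phi i) (submxcol x i)).
  exact: differentiableP.
have := is_diff_comp (linear_cV_is_diff x (@submxcol_linear R N n i)) pd.
rewrite [X in is_diff _ _ X -> _](_ : _ = fun v =>
  (gradmx (@phi i) (submxcol x i))^T *m submxcol v i)//.
by apply/funext => v; rewrite /= tr_gradmx_mul.
Qed.

(** The gradient matrix of the stacked map is block diagonal, since its i-th
    block of components depends on the i-th block of variables only. *)
Lemma gradmx_stack_phi_mul (x : stackX n) (w : stackY R N d) :
  gradmx (stack_phi phi) x *m w =
  \mxcol_i (gradmx (@phi i) (submxcol x i) *m submxcol w i).
Proof.
apply: dot_inj => v; rewrite dot_mull.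
rewrite -[v in RHS]submxcolK dot_mxcol dot_submxcol; apply: eq_bigr => i _.
rewrite dot_mull; congr dot; apply/colP => j.
have RankE (z : stackY R N d) : submxcol z i j 0 = z (tagnat.Rank i j) 0.
  by rewrite mxE.
have e : (fun z : stackX n => stack_phi phi z (tagnat.Rank i j) 0) =
    fun z => phi (submxcol z i) j 0.
  by apply/funext => z; rewrite -RankE mxcolK.
rewrite RankE.
have pd := phi_block_is_diff i x.
have pdd : differentiable (fun z : stackX n => phi (submxcol z i)) x.
  exact: ex_diff.
have pj := is_diff_coord j pdd.
rewrite tr_gradmx_mulE e; last exact: ex_diff.
by rewrite diff_val diff_val.
Qed.

Lemma gradmx_stack_phi_le L (x : stackX n) (w : stackY R N d) :
  0 <= L -> (forall i (u : 'cV[R]_(n i)), opnorm (gradmx (@phi i) u) <= L) ->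
  enorm (gradmx (stack_phi phi) x *m w) <= L * enorm w.
Proof.
move=> L0 hL; apply: le_enorm_blocks => // i.
rewrite gradmx_stack_phi_mul mxcolK (le_trans (opnormP _ _))//.
by rewrite ler_wpM2r ?enorm_ge0.
Qed.

Lemma stack_phi_lipschitz L (x x' : stackX n) :
  0 <= L -> (forall i (u : 'cV[R]_(n i)), opnorm (gradmx (@phi i) u) <= L) ->
  enorm (stack_phi phi x - stack_phi phi x') <= L * enorm (x - x').
Proof.
move=> L0 hL; apply: le_enorm_blocks => // i.
by rewrite !submxcolB !mxcolK gradmx_lipschitz.
Qed.

Lemma sigma_is_diff (x : stackX n) :
  is_diff x (sigma phi : stackX n -> _) (fun v : stackX n => N%:R^-1 *:
    \sum_i (gradmx (@phi i) (submxcol x i))^T *m submxcol v i).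
Proof.
have -> : (sigma phi : stackX n -> _) =
    N%:R^-1 *: \sum_(i < N) (fun z : stackX n => phi (submxcol z i)).
  by apply/funext => z; rewrite /sigma fctE fct_sumE.
have pd i := phi_block_is_diff i x.
have dd : differentiable
    (N%:R^-1 *: \sum_(i < N) (fun z : stackX n => phi (submxcol z i))) x.
  by apply/differentiableZ/differentiable_sum => i; exact: ex_diff.
apply: DiffDef => //; apply/funext => v.
rewrite -deriveE// deriveZ ?derive_sum.
- congr (_ *: _); apply: eq_bigr => i _.
  by rewrite deriveE ?diff_val//; exact: ex_diff.
- by move=> i; apply/diff_derivable/ex_diff.
- by apply/diff_derivable/differentiable_sum => i; exact: ex_diff.
Qed.

(** The joint differential of f_i splits along the two factors, because each
    partial function is f_i composed with the insertion of one argument. *)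
Lemma diff_f i (u : 'cV[R]_(n i)) (s : 'cV[R]_d) v w :
  'd (fun p : 'cV[R]_(n i) * 'cV[R]_d => f p.1 p.2) (u, s) (v, w) =
  dot (grad1 f u s) v + dot (grad2 f u s) w.
Proof.
set F := fun p : _ * _ => _.
have FD : is_diff (u, s) F ('d F (u, s)) by exact/differentiableP/f_diff.
have d1 : is_diff u (fun z => f z s) (fun v => 'd F (u, s) (v, 0)).
  have i1 := is_diff_pair (is_diff_id u) (is_diff_cst s u).
  exact: (is_diff_comp i1 FD).
have d2 : is_diff s (fun z => f u z) (fun v => 'd F (u, s) (0, v)).
  have i1 := is_diff_pair (is_diff_cst u s) (is_diff_id s).
  exact: (is_diff_comp i1 FD).
rewrite /grad1 /grad2 -!diff_grad; try exact: ex_diff.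
have -> : 'd (fun z => f z s) u v = 'd F (u, s) (v, 0) by rewrite (diff_val).
have -> : 'd (fun z => f u z) s w = 'd F (u, s) (0, w) by rewrite (diff_val).
rewrite -linearD; congr ('d F (u, s) _).
by rewrite -[RHS]/(v + 0, 0 + w) addr0 add0r.
Qed.

(** Chain rule. Agent i's variable enters f_i directly and every f_j through the
    average sigma; the second effect contributes
    grad phi_i (x_i) * (1/N) sum_j grad_2 f_j, which is what [Gmap] computes
    once each agent's estimate is the true average. *)
Lemma grad_global (x : stackX n) :
  grad (global phi f) x = Gmap phi f x (\mxcol_i sigma phi x).
Proof.
apply: grad_unique => v.
pose F i := (fun p : 'cV[R]_(n i) * 'cV[R]_d => f p.1 p.2).
pose ds (w : stackX n) : 'cV[R]_d :=
  N%:R^-1 *: \sum_i (gradmx (@phi i) (submxcol x i))^T *m submxcol w i.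
have sd : is_diff x (sigma phi) ds by exact: sigma_is_diff.
have fd i : is_diff x (fun z : stackX n => f (submxcol z i) (sigma phi z))
    (fun v => dot (grad1 f (submxcol x i) (sigma phi x)) (submxcol v i) +
              dot (grad2 f (submxcol x i) (sigma phi x)) (ds v)).
  have FD : is_diff (submxcol x i, sigma phi x) (F i)
      ('d (F i) (submxcol x i, sigma phi x)) by exact/differentiableP/f_diff.
  have := is_diff_comp (is_diff_pair
    (linear_cV_is_diff x (@submxcol_linear R N n i)) sd) FD.
  rewrite [X in is_diff _ _ X -> _](_ : _ = (fun v : stackX n =>
    dot (grad1 f (submxcol x i) (sigma phi x)) (submxcol v i) +
    dot (grad2 f (submxcol x i) (sigma phi x)) (ds v)))//.
  by apply/funext => w /=; rewrite diff_f.
have -> : global phi f =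
    \sum_(i < N) (fun z : stackX n => f (submxcol z i) (sigma phi z)).
  by apply/funext => z; rewrite fct_sumE.
rewrite derive_sum; last by move=> i; apply/diff_derivable/ex_diff.
have -> : \sum_i 'D_v (fun z : stackX n => f (submxcol z i) (sigma phi z)) x =
    \sum_i (dot (grad1 f (submxcol x i) (sigma phi x)) (submxcol v i) +
            dot (grad2 f (submxcol x i) (sigma phi x)) (ds v)).
  by apply: eq_bigr => i _; rewrite deriveE ?diff_val//; exact: ex_diff.
rewrite big_split/= /Gmap dotDl; congr (_ + _).
  rewrite dot_submxcol; apply: eq_bigr => i _.
  by rewrite /stack_grad1 !mxcolK.
rewrite gradmx_stack_phi_mul dot_submxcol.
under [RHS]eq_bigr => i _ do rewrite !mxcolK dot_mull dotZl.
rewrite /ds; under [LHS]eq_bigr => i _ do rewrite dotZr.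
rewrite -!mulr_sumr; congr (_ * _).
under [RHS]eq_bigr => i _ do rewrite dotC dot_sumr.
rewrite [RHS]exchange_big/=; apply: eq_bigr => j _.
rewrite dot_sumr; apply: eq_bigr => i _.
by rewrite mxcolK dotC.
Qed.

End AggregativeCalculus.

(** * Gradient descent for strongly convex smooth functions *)

Section Optimization.
Context {R : realType}.

(** With D := C / (1 - q), the sequences u k - D q^k and u k + D q^k are
    respectively nondecreasing and nonincreasing, so they enclose a common
    real, namely the supremum of the former. *)
Lemma geometric_step_cvg (u : nat -> R) C q : q < 1 ->
  (forall k, `|u k.+1 - u k| <= C * q ^+ k) ->
  exists l, forall k, `|u k - l| <= C / (1 - q) * q ^+ k.
Proof.
move=> q1 uC; have q1' : 1 - q != 0 by rewrite subr_eq0 gt_eqF.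
set D := C / (1 - q).
have DC k : D * q ^+ k - D * q ^+ k.+1 = C * q ^+ k.
  by rewrite exprS /D; field.
pose a k := u k - D * q ^+ k; pose b k := u k + D * q ^+ k.
have adj k : `|u k.+1 - u k| <= D * q ^+ k - D * q ^+ k.+1 by rewrite DC.
have aS : {homo a : i j / (i <= j)%N >-> i <= j}.
  apply: homo_leq => [|y x z|k]; [exact: lexx|exact: le_trans|].
  by move: (adj k); rewrite ler_norml /a => /andP[]; lra.
have bS : {homo b : i j / (i <= j)%N >-> j <= i}.
  apply: homo_leq => [|y x z|k]; [exact: lexx|move=> /[swap]; exact: le_trans|].
  by move: (adj k); rewrite ler_norml /b => /andP[]; lra.
have ab_same k : a k <= b k.
  have C0 : 0 <= C * q ^+ k by rewrite (le_trans _ (uC k)).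
  have : 0 <= D * q ^+ k.
    by rewrite /D mulrAC divr_ge0// subr_ge0 ltW.
  by rewrite /a /b; lra.
have ab i j : a i <= b j.
  have := ab_same (maxn i j).
  have := aS _ _ (leq_maxl i j); have := bS _ _ (leq_maxr i j); lra.
have hub : has_ubound (range a) by exists (b 0) => _ [i _ <-].
have al k : a k <= sup (range a) by apply: (@ub_le_sup _ _ hub); exists k.
have lb k : sup (range a) <= b k.
  by apply: ge_sup; [exists (a 0), 0 | move=> _ [i _ <-]; exact: ab].
exists (sup (range a)) => k; rewrite ler_distl.
by have := al k; have := lb k; rewrite /a /b; lra.
Qed.

Lemma le0_of_geometric (y C q : R) : 0 <= q < 1 ->
  (forall k, y <= C * q ^+ k) -> y <= 0.
Proof.
move=> /andP[q0 q1] yC.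
have h : (C * q ^+ k @[k --> \oo] --> 0)%classic.
  by apply: cvg_geometric; rewrite ger0_norm.
rewrite -(cvg_lim (@Rhausdorff R) h); apply: limr_ge.
  by apply/cvg_ex; exists 0.
by apply: nearW.
Qed.

(** Banach's fixed point theorem for the Euclidean norm: the coordinates of the
    iterates of 0 converge geometrically, and the distance by which T moves the
    vector of their limits is bounded by every term of a geometric sequence. *)
Lemma contraction_fixpoint m (T : 'cV[R]_m -> 'cV[R]_m) r : 0 <= r < 1 ->
  (forall x y, enorm (T x - T y) <= r * enorm (x - y)) -> exists x, T x = x.
Proof.
move=> /andP[r0 r1] hT; pose x k := iter k T 0.
have step k : enorm (x k.+1 - x k) <= enorm (T 0) * r ^+ k.
  elim: k => [|k IH]; first by rewrite /x/= subr0 mulr1.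
  by rewrite exprSr mulrA mulrC (le_trans (hT _ _))// ler_wpM2l.
have /choice[l hl] : forall i : 'I_m, exists l, forall k,
    `|x k i 0 - l| <= enorm (T 0) / (1 - r) * r ^+ k.
  move=> i; apply: geometric_step_cvg => // k.
  apply: le_trans (step k).
  by have := coord_le_enorm (x k.+1 - x k) i; rewrite !mxE.
set K := enorm (T 0) / (1 - r) in hl.
have xl k : enorm (x k - \col_i l i) <= m%:R * K * r ^+ k.
  apply: le_trans (enorm_le_sum _) _.
  rewrite -mulrA mulr_natl -[X in _ *+ X]card_ord -sumr_const.
  by apply: ler_sum => i _; rewrite !mxE.
exists (\col_i l i); set z := \col_i l i in xl *; apply/subr0_eq/enorm_eq0.
apply/le_anti; rewrite enorm_ge0 andbT.
apply: (@le0_of_geometric _ (2 * (m%:R * K)) r); first by rewrite r0.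
move=> k; have -> : T z - z = (T z - x k.+1) + (x k.+1 - z).
  by rewrite addrA subrK.
apply: le_trans (enormD _ _) _.
have h1 : enorm (T z - x k.+1) <= m%:R * K * r ^+ k.
  apply: le_trans (hT _ _) _; rewrite enormBC.
  by apply: le_trans (xl k); rewrite ler_piMl ?enorm_ge0//; exact: ltW.
have h2 : enorm (x k.+1 - z) <= m%:R * K * r ^+ k.
  apply: le_trans (xl k.+1) _; rewrite exprS mulrCA ler_piMl//; last exact: ltW.
  by apply: le_trans (xl k); exact: enorm_ge0.
by lra.
Qed.

Section GradientStep.
Context {m : nat} (F : 'cV[R]_m -> R) (mu L a : R).
Hypotheses (mu_gt0 : 0 < mu) (a_gt0 : 0 < a) (aL : a * L < 1).
Hypotheses (Fmu : strongly_convex mu F) (FL : smooth L F).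

Let sc (x y : 'cV[R]_m) :
  F y + dot (grad F y) (x - y) + mu / 2 * dot (x - y) (x - y) <= F x.
Proof. by have := Fmu x y; rewrite sqr_enorm. Qed.

(* Descent inequality. The usual proof integrates the gradient and gets L / 2;
   here strong convexity at the other endpoint gives L - mu / 2. For
   F - (mu / 2) |.|^2 the constant is L - mu instead of (L - mu) / 2, a loss of a
   factor 2 that the stepsize condition a * L < 1 absorbs. *)
Let quad (x y : 'cV[R]_m) :
  F x <= F y + dot (grad F y) (x - y) + (L - mu / 2) * dot (x - y) (x - y).
Proof.
have h1 := sc y x.
have h2 : dot (grad F x - grad F y) (x - y) <= L * dot (x - y) (x - y).
  apply: le_trans (dot_le _ _) _; rewrite -sqr_enorm expr2 mulrA.
  by rewrite ler_wpM2r ?enorm_ge0.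
rewrite -(opprB x y) !(dotNl, dotNr) in h1.
by move: h2; rewrite dotDl dotNl; lra.
Qed.

(** The quadratic lower and upper bounds on F at two distinct points would
    otherwise be incompatible. *)
Lemma strongly_convex_smooth_le (x y : 'cV[R]_m) : x != y -> mu <= L.
Proof.
move=> xy; have h1 := sc x y; have h2 := quad x y.
have : 0 < dot (x - y) (x - y).
  rewrite lt_def dot_ge0 andbT; apply: contra_neq xy => h.
  by apply/subr0_eq/dot_eq0.
by nra.
Qed.

(* D is the increment of the gradient of h := F - (mu / 2) |.|^2. Comparing the
   lower bound from x and the upper bound from y at the test point y - t D
   gives half of the cocoercivity of the gradient of h; the other half is
   obtained by exchanging x and y. *)
Let half_coco (x y : 'cV[R]_m) t : 0 <= t -> (L - mu) * t <= 1 / 2 ->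
  forall D, D = grad F y - grad F x - mu *: (y - x) ->
  F x + dot (grad F x) (y - x) + mu / 2 * dot (y - x) (y - x)
    + t / 2 * dot D D <= F y.
Proof.
move=> t0 ht D eD; set V := y - x; pose w := y - t *: D.
have gy : grad F y = grad F x + D + mu *: V.
  by rewrite eD -/V -addrA subrK addrC subrK.
have wx : w - x = V - t *: D by rewrite /w /V addrAC.
have wy : w - y = - (t *: D) by rewrite /w addrAC subrr add0r.
have := sc w x; have := quad w y; rewrite wx wy gy; clearbody V w.
rewrite !(dotDl, dotDr, dotNl, dotNr, dotZl, dotZr) (dotC D V).
have D0 := dot_ge0 D.
have : (L - mu) * t * (t * dot D D) <= 1 / 2 * (t * dot D D).
  by rewrite ler_wpM2r// mulr_ge0.
set c1 := dot (grad F x) V; set c2 := dot (grad F x) D.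
set c3 := dot V V; set c4 := dot V D; set c5 := dot D D.
by move: (F x) (F y) (F w) => Fx Fy Fw; lra.
Qed.

(** The sharp factor 1 - a mu (and not its square root) is what makes the
    stepsize bound attainable. With h := F - (mu / 2) |.|^2, V := x - y and D
    the increment of the gradient of h, the difference of the two steps is
    (1 - a mu) V - a D, and it is no longer than (1 - a mu) V as soon as
    a |D|^2 <= 2 (1 - a mu) <D, V>, a cocoercivity estimate. *)
Lemma gradient_step_contraction (x y : 'cV[R]_m) :
  enorm ((x - a *: grad F x) - (y - a *: grad F y)) <=
    (1 - a * mu) * enorm (x - y).
Proof.
have [->|xy] := eqVneq x y; first by rewrite !subrr !enorm0 mulr0.
have muL := strongly_convex_smooth_le xy.
have amu : 0 < 1 - a * mu by rewrite subr_gt0 (le_lt_trans _ aL)// ler_pM2l.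
pose t := a / (2 * (1 - a * mu)).
have t0 : 0 <= t by rewrite divr_ge0 ?mulr_ge0// ltW.
have aE : a = 2 * (1 - a * mu) * t by rewrite /t; field; rewrite lt0r_neq0.
have tL : (L - mu) * t <= 1 / 2.
  rewrite /t mulrA ler_pdivrMr ?mulr_gt0// mulrA div1r mulVf ?pnatr_eq0//.
  by rewrite mul1r mulrBl (mulrC mu) lerD2r mulrC ltW.
set V := x - y; set D := grad F x - grad F y - mu *: V.
have Dxy : grad F y - grad F x - mu *: (y - x) = - D.
  by rewrite /D /V -scalerN !opprB addrC.
have h2 : grad F x = grad F y + D + mu *: V by rewrite /D -addrA subrK addrC subrK.
have stepE : (x - a *: (grad F y + D + mu *: V)) - (y - a *: grad F y) =
    (1 - a * mu) *: V - a *: D.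
  by rewrite /V; apply/colP => i; rewrite !mxE; ring.
have := half_coco t0 tL (esym Dxy).
have := half_coco t0 tL (erefl D).
rewrite -(opprB x y) -/V h2; clearbody D V.
rewrite !(dotDl, dotDr, dotNl, dotNr, dotZl, dotZr) => h3 h4.
have coco : t * dot D D <= dot D V by lra.
rewrite stepE.
apply: le_enorm; first exact: ltW.
rewrite !(dotDl, dotDr, dotNl, dotNr, dotZl, dotZr) (dotC V D).
have : 2 * (a * (1 - a * mu)) * (t * dot D D) <=
    2 * (a * (1 - a * mu)) * dot D V.
  by rewrite ler_wpM2l// !mulr_ge0// ltW.
have -> : 2 * (a * (1 - a * mu)) * (t * dot D D) = a * a * dot D D.
  by rewrite {3}aE; ring.
by lra.
Qed.

(** A fixed point of the gradient step is a critical point, and strong convexity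
    at a critical point x gives F z >= F x + (mu / 2) |z - x|^2. *)
Lemma minimizer_exists :
  exists x, grad F x = 0 /\ unique (minimizer F) x.
Proof.
(* in dimension 0 the number 1 - a mu may be negative, hence the maximum *)
have r01 : 0 <= Num.max (1 / 2) (1 - a * mu) < 1.
  rewrite le_max gt_max divr_ge0//= ltr_pdivrMr// mul1r ltr1n/=.
  by rewrite ltrBlDr ltrDl mulr_gt0.
have [x Tx] : exists x, x - a *: grad F x = x.
  apply: (contraction_fixpoint r01) => x y.
  apply: le_trans (gradient_step_contraction x y) _.
  by rewrite ler_wpM2r ?enorm_ge0// le_max lexx orbT.
have gx : grad F x = 0.
  have : a *: grad F x = 0.
    by apply/oppr_inj/(addrI x); rewrite Tx oppr0 addr0.
  by move/eqP; rewrite scaler_eq0 gt_eqF//= => /eqP.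
have lo z : F x + mu / 2 * dot (z - x) (z - x) <= F z.
  by have := sc z x; rewrite gx /dot trmx0 mul0mx mxE addr0.
exists x; split => //; split.
  move=> z; apply: le_trans (lo z).
  by rewrite lerDl mulr_ge0 ?dot_ge0// divr_ge0// ltW.
move=> z zmin; apply/esym/subr0_eq/dot_eq0.
have : mu / 2 * dot (z - x) (z - x) <= 0.
  by rewrite -(lerD2l (F x)) addr0 (le_trans (lo z)).
rewrite pmulr_rle0 ?divr_gt0// => zx.
by apply/le_anti; rewrite zx dot_ge0.
Qed.

End GradientStep.
End Optimization.

(** * Averaging over the network *)

Section Consensus.
Context {R : realType} {N : nat} {d : nat}.
Local Notation Y := (stackY R N d).

(** The action on [s] of the Kronecker product of [A] and the identity of R^d. *)
Definition mix (A : 'M[R]_N) (s : Y) : Y :=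
  \mxcol_i \sum_j A i j *: submxcol s j.

Definition avg (s : Y) : 'cV[R]_d := N%:R^-1 *: \sum_i submxcol s i.

Definition replicate (v : 'cV[R]_d) : Y := \mxcol_(i < N) v.

Definition dev (s : Y) : Y := s - replicate (avg s).

Lemma avgB s s' : avg (s - s') = avg s - avg s'.
Proof.
rewrite /avg -scalerBr -sumrB; congr (_ *: _).
by apply: eq_bigr => i _; rewrite submxcolB.
Qed.

Lemma avgD s s' : avg (s + s') = avg s + avg s'.
Proof.
rewrite /avg -scalerDr -big_split; congr (_ *: _).
by apply: eq_bigr => i _; rewrite submxcolD.
Qed.

Lemma replicateB u v : replicate (u - v) = replicate u - replicate v.
Proof. by apply/mxcolP => i; rewrite submxcolB !mxcolK. Qed.

Lemma devB s s' : dev (s - s') = dev s - dev s'.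
Proof. by rewrite /dev avgB replicateB !opprD !opprK addrACA. Qed.

Lemma devD s s' : dev (s + s') = dev s + dev s'.
Proof. by apply/(canRL (subrK _)); rewrite -devB addrK. Qed.

Lemma mixBl A B s : mix (A - B) s = mix A s - mix B s.
Proof.
apply/mxcolP => i; rewrite submxcolB !mxcolK -sumrB.
by apply: eq_bigr => j _; rewrite !mxE scalerBl.
Qed.

Lemma mixBr A s s' : mix A (s - s') = mix A s - mix A s'.
Proof.
apply/mxcolP => i; rewrite submxcolB !mxcolK -sumrB.
by apply: eq_bigr => j _; rewrite submxcolB scalerBr.
Qed.

Lemma mix1 s : mix 1%:M s = s.
Proof.
apply/mxcolP => i; rewrite mxcolK (bigD1 i)//= mxE eqxx scale1r big1 ?addr0//.
by move=> j ji; rewrite mxE eq_sym (negbTE ji) scale0r.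
Qed.

Lemma avgmxE (i j : 'I_N) : avgmx i j = N%:R^-1 :> R.
Proof. by rewrite !mxE big_ord1 !mxE !mulr1. Qed.

Lemma mix_avgmx s : mix avgmx s = replicate (avg s).
Proof.
apply/mxcolP => i; rewrite !mxcolK /avg scaler_sumr.
by apply: eq_bigr => j _; rewrite avgmxE.
Qed.

Lemma mix_replicate (A : 'M[R]_N) v : (forall i, \sum_j A i j = 1) ->
  mix A (replicate v) = replicate v.
Proof.
move=> A1; apply/mxcolP => i; rewrite !mxcolK.
under eq_bigr do rewrite mxcolK.
by rewrite -scaler_suml A1 scale1r.
Qed.

Lemma avg_mix (A : 'M[R]_N) s :
  (forall j, \sum_i A i j = 1) -> avg (mix A s) = avg s.
Proof.
move=> A1; rewrite /avg; congr (_ *: _).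
under eq_bigr do rewrite mxcolK.
by rewrite exchange_big; apply: eq_bigr => j _; rewrite -scaler_suml A1 scale1r.
Qed.

(** Each of the d coordinates is mixed separately by [A]. *)
Lemma enorm_mix A s : enorm (mix A s) <= opnorm A * enorm s.
Proof.
apply: le_enorm; first exact: opnorm_ge0.
(* the c-th coordinates of all the agents' vectors *)
pose col_ c : 'cV[R]_N := \col_j submxcol s j c 0.
rewrite !dot_submxcol.
under eq_bigr do rewrite mxcolK dotE.
under [in leRHS]eq_bigr do rewrite dotE.
rewrite exchange_big [in leRHS]exchange_big/= mulr_sumr ler_sum// => c _.
have -> : \sum_j submxcol s j c 0 * submxcol s j c 0 = enorm (col_ c) ^+ 2.
  by rewrite sqr_enorm dotE; apply: eq_bigr => j _; rewrite !mxE.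
have -> : \sum_i (\sum_j A i j *: submxcol s j) c 0 *
    (\sum_j A i j *: submxcol s j) c 0 = enorm (A *m col_ c) ^+ 2.
  rewrite sqr_enorm dotE; apply: eq_bigr => i _.
  rewrite !summxE !mxE; congr (_ * _); apply: eq_bigr => j _; rewrite !mxE//.
rewrite -exprMn ler_pXn2r// ?nnegrE ?enorm_ge0// ?opnormP//.
by rewrite mulr_ge0 ?opnorm_ge0 ?enorm_ge0.
Qed.

Lemma avg_dev (N_gt0 : (0 < N)%N) s : avg (dev s) = 0.
Proof.
rewrite /dev avgB; apply/eqP; rewrite subr_eq0; apply/eqP.
rewrite [RHS]/avg; under [in RHS]eq_bigr do rewrite mxcolK.
rewrite sumr_const card_ord -scalerMnr scalerMnl -mulr_natr mulVf ?scale1r//.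
by rewrite pnatr_eq0 -lt0n.
Qed.

(** The average is invariant under mixing and agreement is a fixed point of
    it, so on disagreements [A] acts as [A - avgmx]. *)
Lemma dev_mix (A : 'M[R]_N) s (N_gt0 : (0 < N)%N) : doubly_stochastic A ->
  dev (mix A s) = mix (A - avgmx) (dev s).
Proof.
move=> [Ar Ac]; rewrite mixBl mix_avgmx avg_dev// [in RHS]/dev mixBr.
rewrite mix_replicate// /dev avg_mix//.
by rewrite -(subrr 0) replicateB subrr subr0.
Qed.

(** With m the mean of the entries of v, the product avgmx v is the constant
    vector m, orthogonal to (A - avgmx) v; hence
    |(A - avgmx) v|^2 = |A v|^2 - |avgmx v|^2, and |A v| <= |v| by convexity of
    the square. *)
Lemma opnorm_stochastic (A : 'M[R]_N) : (0 < N)%N -> (forall i j, 0 <= A i j) ->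
  doubly_stochastic A -> opnorm (A - avgmx) <= 1.
Proof.
move=> N_gt0 A0 [Ar Ac]; apply: opnorm_le => // v; apply: le_enorm => //.
rewrite expr1n mul1r.
have NR : N%:R != 0 :> R by rewrite pnatr_eq0 -lt0n.
set m := N%:R^-1 * \sum_i v i 0.
have Jv : avgmx *m v = const_mx m.
  apply/colP => i; rewrite mxE [RHS]mxE /m mulr_sumr.
  by apply: eq_bigr => j _; rewrite avgmxE.
have sumA : \sum_i (A *m v) i 0 = N%:R * m.
  under eq_bigr do rewrite mxE.
  rewrite exchange_big/= /m mulrA mulfV// mul1r.
  by apply: eq_bigr => j _; rewrite -mulr_suml Ac mul1r.
have cross : dot (A *m v) (const_mx m) = N%:R * m * m.
  rewrite dotE -sumA mulr_suml; apply: eq_bigr => i _.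
  by rewrite [const_mx _ _ _]mxE.
have JJ : dot (const_mx m : 'cV[R]_N) (const_mx m) = N%:R * m * m.
  rewrite dotE; under eq_bigr do rewrite !mxE.
  by rewrite sumr_const card_ord -[LHS]mulr_natl mulrA.
(* Jensen's inequality for the rows of A, summed over the columns *)
have Av : dot (A *m v) (A *m v) <= dot v v.
  rewrite !dotE.
  have -> : \sum_i v i 0 * v i 0 = \sum_i \sum_j A i j * (v j 0 * v j 0).
    rewrite exchange_big/=; apply: eq_bigr => j _.
    by rewrite -mulr_suml Ac mul1r.
  apply: ler_sum => i _; set y := (A *m v) i 0.
  have : 0 <= \sum_j A i j * (v j 0 - y) ^+ 2.
    by apply: sumr_ge0 => j _; rewrite mulr_ge0 ?sqr_ge0.
  have -> : \sum_j A i j * (v j 0 - y) ^+ 2 =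
      \sum_j A i j * (v j 0 * v j 0) - 2 * y * \sum_j A i j * v j 0
      + y ^+ 2 * \sum_j A i j.
    rewrite !mulr_sumr -sumrB -big_split; apply: eq_bigr => j _ /=; ring.
  have -> : \sum_j A i j * v j 0 = y by rewrite /y mxE.
  by rewrite Ar; lra.
rewrite mulmxBl Jv !(dotDl, dotDr, dotNl, dotNr) (dotC (const_mx m)) cross JJ.
have : 0 <= N%:R * m * m by rewrite -mulrA mulr_ge0// -expr2 sqr_ge0.
by lra.
Qed.

(** [dev] is the mixing by 1 - avgmx, and the identity is doubly stochastic. *)
Lemma enorm_dev s : (0 < N)%N -> enorm (dev s) <= enorm s.
Proof.
move=> N_gt0; have -> : dev s = mix (1%:M - avgmx) s.
  by rewrite mixBl mix1 mix_avgmx.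
apply: le_trans (enorm_mix _ _) _; rewrite ler_piMl ?enorm_ge0//.
apply: opnorm_stochastic => // [i j|]; first by rewrite mxE; case: eqP.
split=> i.
  rewrite (bigD1 i)//= mxE eqxx big1 ?addr0// => j ji.
  by rewrite mxE eq_sym (negbTE ji).
rewrite (bigD1 i)//= mxE eqxx big1 ?addr0// => j ji.
by rewrite mxE (negbTE ji).
Qed.

Lemma enorm_dev_mix A s : (0 < N)%N -> doubly_stochastic A ->
  enorm (dev (mix A s)) <= opnorm (A - avgmx) * enorm (dev s).
Proof. by move=> N_gt0 dA; rewrite dev_mix// enorm_mix. Qed.

Lemma enorm_mix_sub (A : 'M[R]_N) s : (0 < N)%N -> (forall i j, 0 <= A i j) ->
  doubly_stochastic A -> enorm (mix A s - s) <= 2 * enorm (dev s).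
Proof.
move=> N_gt0 A0 dA; have -> : mix A s - s = dev (mix A s) - dev s.
  by rewrite /dev avg_mix; [rewrite opprB addrA subrK | exact: (proj2 dA)].
apply: le_trans (enormB _ _) _; rewrite mulrDl mul1r lerD2r.
apply: le_trans (enorm_dev_mix _ _ _) _ => //.
by rewrite ler_piMl ?enorm_ge0 ?opnorm_stochastic.
Qed.

End Consensus.

(** * A Lyapunov function for the coupled recursions *)

Section Lyapunov.
Context {R : realType}.

(** The weights b, c solve, with equality, the last two conditions in which
    theta is replaced by the largest value M / L1 (M := mu + L1) allowed by the
    first one. The bound on a then says that theta < M / L1 for these weights,
    which makes all three conditions strict. *)
Lemma lyapunov_weights (mu L1 L2 L3 p a : R) :
  0 < mu -> 0 < L1 -> 0 <= L2 -> 0 < L3 -> 0 < p -> 0 < a ->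
  a < mu * p ^+ 2 / (L3 * (mu + L1 + L1 * L3) *
        (p * (L1 + L2 + L2 * L3) + 2 * L2 * L3)) ->
  exists b c : R, let theta := 1 + L3 * b + L2 * (1 + L3) * c in
    [/\ 0 < b, 0 < c, L1 * theta < mu + L1,
        a * L1 * theta + 2 * L2 * c < p * b & a * L3 * theta < p * c].
Proof.
move=> mu0 L10 L20 L30 p0 a0 alt.
have L23 : 0 <= L2 * L3 by rewrite mulr_ge0// ltW.
set K := p * (L1 + L2 + L2 * L3) + 2 * L2 * L3 in alt.
have K0 : 0 < K.
  have L223 : 0 <= 2 * L2 * L3 by rewrite -mulrA mulr_ge0.
  by rewrite ltr_wpDr// mulr_gt0// ltr_wpDr// ltr_wpDr.
set M := mu + L1; have M0 : 0 < M by rewrite addr_gt0.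
have den0 : 0 < L3 * (M + L1 * L3) * K by rewrite !mulr_gt0// addr_gt0// mulr_gt0.
have small : a * L3 * M * K < mu * p ^+ 2.
  rewrite ltr_pdivlMr// in alt; apply: le_lt_trans alt.
  rewrite -!mulrA ler_wpM2l ?(ltW a0)// ler_wpM2l ?(ltW L30)//.
  by rewrite ler_wpM2r ?(ltW K0)// lerDl mulr_ge0// ?ltW.
pose c := a * L3 * M / (p * L1); pose b := (a * M + 2 * L2 * c) / p.
have c0 : 0 < c by rewrite divr_gt0 ?mulr_gt0.
have b0 : 0 < b.
  have Lc0 : 0 <= 2 * L2 * c by apply: mulr_ge0; [exact: mulr_ge0 | exact: ltW].
  by rewrite divr_gt0// ltr_wpDr// mulr_gt0.
exists b, c => theta.
have thetaE : L1 * theta = L1 + a * L3 * M * K / p ^+ 2.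
  by rewrite /theta /b /c /K; field; rewrite !gt_eqF.
have thetaM : L1 * theta < M.
  by rewrite thetaE /M addrC ltrD2r ltr_pdivrMr// exprn_gt0.
have pb : p * b = a * M + 2 * L2 * c by rewrite /b mulrCA mulfV ?mulr1 // gt_eqF.
have pc : p * c = a * L3 * (M / L1) by rewrite /c; field; rewrite !gt_eqF.
split => //.
  by rewrite pb ltrD2r -mulrA ltr_pM2l.
by rewrite pc ltr_pM2l ?mulr_gt0// ltr_pdivlMr// mulrC.
Qed.

(** The combination e + b s + c t is multiplied at each step by at most the
    largest of three ratios, one for each of e, s, t, all less than 1 by the
    choice of b and c. *)
Lemma coupled_recursion_rate (mu L1 L2 L3 rho a : R) (e s t delta : nat -> R) :
  0 < mu -> 0 < L1 -> 0 <= L2 -> 0 < L3 -> rho < 1 -> 0 < a ->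
  a < mu * (1 - rho) ^+ 2 / (L3 * (mu + L1 + L1 * L3) *
        ((1 - rho) * (L1 + L2 + L2 * L3) + 2 * L2 * L3)) ->
  (forall k, 0 <= e k) -> (forall k, 0 <= s k) -> (forall k, 0 <= t k) ->
  (forall k, delta k <= a * (L1 * e k + L1 * s k + L3 * t k)) ->
  (forall k, e k.+1 <= (1 - a * mu) * e k + a * (L1 * s k + L3 * t k)) ->
  (forall k, s k.+1 <= rho * s k + L3 * delta k) ->
  (forall k, t k.+1 <= rho * t k + L2 * (delta k + (2 * s k + L3 * delta k))) ->
  exists C q : R, [/\ 0 <= C, 0 < q < 1 & forall k, e k <= C * q ^+ k].
Proof.
move=> mu0 L10 L20 L30 rho1 a0 alt e0 s0 t0 hdelta he hs ht.
have p0 : 0 < 1 - rho by rewrite subr_gt0.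
have [b [c]] := lyapunov_weights mu0 L10 L20 L30 p0 a0 alt.
set theta := 1 + _ + _ => -[b0 c0 w1 w2 w3].
pose V k := e k + b * s k + c * t k.
pose q1 := 1 - a * (mu + L1 - L1 * theta).
pose q2 := a * L1 * theta + 2 * L2 * c + rho * b.
pose q3 := a * L3 * theta + rho * c.
have q11 : q1 < 1 by rewrite /q1 gtrBl mulr_gt0// subr_gt0.
have q21 : q2 / b < 1 by rewrite ltr_pdivrMr// /q2; lra.
have q31 : q3 / c < 1 by rewrite ltr_pdivrMr// /q3; lra.
have [q q01 [qq1 qq2 qq3]] : exists2 q, 0 < q < 1 &
    [/\ q1 <= q, q2 <= q * b & q3 <= q * c].
  (* 1 / 2 only ensures that q is positive *)
  exists (Num.max (1 / 2) (Num.max q1 (Num.max (q2 / b) (q3 / c)))).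
    by rewrite lt_max divr_gt0//= !gt_max q11 q21 q31 ltr_pdivrMr// mul1r ltr1n.
  by rewrite -!ler_pdivrMr// !le_max !lexx !orbT.
have V0 k : 0 <= V k.
  by rewrite /V !addr_ge0// mulr_ge0// ?ltW.
have VS k : V k.+1 <= q * V k.
  have h1 : V k.+1 <= q1 * e k + q2 * s k + q3 * t k.
    have w : 0 <= L3 * b + L2 * (1 + L3) * c.
      have L31 : 0 <= 1 + L3 by rewrite addr_ge0// ?ltW.
      by rewrite addr_ge0// ?mulr_ge0// ?ltW.
    have hd := ler_wpM2l w (hdelta k).
    have hsb := ler_wpM2l (ltW b0) (hs k).
    have htc := ler_wpM2l (ltW c0) (ht k).
    have := he k; rewrite /V /q1 /q2 /q3 /theta.
    move: (e k.+1) (s k.+1) (t k.+1) (e k) (s k) (t k) (delta k) hd hsb htc.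
    by move=> e' s' t' ek sk tk dk; clear; lra.
  apply: le_trans h1 _; rewrite /V !mulrDr !mulrA.
  by rewrite !lerD// ler_wpM2r.
exists (V 0), q; split=> // k.
have Vk : V k <= V 0 * q ^+ k.
  elim: k => [|k IH]; first by rewrite mulr1.
  rewrite exprS mulrCA (le_trans (VS k))// ler_wpM2l//.
  by case/andP: q01 => /ltW.
apply: le_trans Vk; rewrite /V -addrA lerDl.
by apply: addr_ge0; apply: mulr_ge0 => //; exact: ltW.
Qed.

End Lyapunov.

(** * Error recursions of the DGT algorithm *)

Section Tracking.
Context {R : realType} {N : nat} {n : 'I_N -> nat} {d : nat}.
Variables (phi : forall i, 'cV[R]_(n i) -> 'cV[R]_d).
Variables (f : forall i, 'cV[R]_(n i) -> 'cV[R]_d -> R).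

Definition stateX (st : @dgt_state R N n d) : stackX n := \mxcol_i dgt_x st i.
Definition stateS (st : @dgt_state R N n d) : stackY R N d :=
  \mxcol_i dgt_sigma st i.
Definition stateY (st : @dgt_state R N n d) : stackY R N d :=
  \mxcol_i dgt_y st i.

Lemma avg_stack_phi x : avg (stack_phi phi x) = sigma phi x.
Proof.
by rewrite /avg /sigma; congr (_ *: _); apply: eq_bigr => i _; rewrite mxcolK.
Qed.

Section Step.
Hypothesis phi_diff : forall i (u : 'cV[R]_(n i)), differentiable (@phi i) u.
Variables (A : 'M[R]_N) (alpha : R).
Local Notation step := (dgt_step phi f A alpha).

Lemma stateX_step st : stateX (step st) = stateX st -
  alpha *: (stack_grad1 f (stateX st) (stateS st) +
            gradmx (stack_phi phi) (stateX st) *m stateY st).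
Proof.
case: st => x s y; apply/mxcolP => i.
rewrite gradmx_stack_phi_mul// submxcolB submxcolZ submxcolD.
by rewrite /stateX /stateS /stateY /stack_grad1 !mxcolK.
Qed.

Lemma stateS_step st : stateS (step st) =
  mix A (stateS st) +
  (stack_phi phi (stateX (step st)) - stack_phi phi (stateX st)).
Proof.
case: st => x s y; apply/mxcolP => i.
rewrite submxcolD submxcolB /mix /stateX /stateS /stack_phi !mxcolK addrA.
by under [in RHS]eq_bigr do rewrite mxcolK.
Qed.

Lemma stateY_step st : stateY (step st) =
  mix A (stateY st) +
  (stack_grad2 f (stateX (step st)) (stateS (step st)) -
   stack_grad2 f (stateX st) (stateS st)).
Proof.
case: st => x s y; apply/mxcolP => i.
rewrite submxcolD submxcolB /mix /stateX /stateS /stateY /stack_grad2.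
rewrite !mxcolK addrA.
by under [in RHS]eq_bigr do rewrite mxcolK.
Qed.

(** Gradient tracking: mixing preserves averages and the increments added to the
    estimates telescope, so the averages of the estimates are exact. *)
Lemma tracking x0 k : doubly_stochastic A ->
  let st := dgt phi f A alpha x0 k in
  avg (stateS st) = sigma phi (stateX st) /\
  avg (stateY st) = avg (stack_grad2 f (stateX st) (stateS st)).
Proof.
move=> [_ Ac]; elim: k => [|k [IHs IHy]] /=.
  rewrite -avg_stack_phi; split; congr avg; apply/mxcolP => i.
    by rewrite /stateX /stateS /stack_phi !mxcolK.
  by rewrite /stateX /stateS /stateY /stack_grad2 !mxcolK.
rewrite -/(dgt phi f A alpha x0 k) in IHs IHy *.
set st := dgt _ _ _ _ _ _ in IHs IHy *; split.
  rewrite [in LHS]stateS_step avgD avgB avg_mix// !avg_stack_phi IHs.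
  by rewrite addrC subrK.
by rewrite [in LHS]stateY_step avgD avgB avg_mix// IHy addrC subrK.
Qed.

End Step.

Section Errors.
Hypothesis N_gt0 : (0 < N)%N.
Hypothesis phi_diff : forall i (u : 'cV[R]_(n i)), differentiable (@phi i) u.
Hypothesis f_diff : forall i (u : 'cV[R]_(n i)) (s : 'cV[R]_d),
  differentiable (fun p : 'cV[R]_(n i) * 'cV[R]_d => f p.1 p.2) (u, s).
Variables (A : 'M[R]_N) (alpha mu L1 L2 L3 : R) (x0 : forall i, 'cV[R]_(n i)).
Hypotheses (A_ge0 : forall i j, 0 <= A i j) (A_ds : doubly_stochastic A).
Hypotheses (mu_gt0 : 0 < mu) (alpha_gt0 : 0 < alpha) (alphaL : alpha * L1 < 1).
Hypotheses (L1_gt0 : 0 < L1) (L2_ge0 : 0 <= L2) (L3_gt0 : 0 < L3).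
Hypothesis F_convex : strongly_convex mu (global phi f).
Hypothesis F_smooth : smooth L1 (global phi f).
Hypothesis G_lip : forall (x x' : stackX n) (y y' : stackY R N d),
  enorm (Gmap phi f x y - Gmap phi f x' y')
    <= L1 * (enorm (x - x') + enorm (y - y')).
Hypothesis grad2_lip : forall (x x' : stackX n) (y y' : stackY R N d),
  enorm (stack_grad2 f x y - stack_grad2 f x' y')
    <= L2 * (enorm (x - x') + enorm (y - y')).
Hypothesis phi_bound : forall i (u : 'cV[R]_(n i)),
  opnorm (gradmx (@phi i) u) <= L3.
Variable xs : @stackX R N n.
Hypothesis xs_crit : grad (global phi f) xs = 0.

Let st k := dgt phi f A alpha x0 k.
Let X k := stateX (st k).
Let S k := stateS (st k).
Let Y k := stateY (st k).
Let e k := enorm (X k - xs).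
Let s k := enorm (dev (S k)).
Let t k := enorm (dev (Y k)).
Let delta k := enorm (X k.+1 - X k).
Let rho := opnorm (A - avgmx).
Let g k := stack_grad1 f (X k) (S k) + gradmx (stack_phi phi) (X k) *m Y k.

Let XS k : X k.+1 = X k - alpha *: g k.
Proof. exact: stateX_step. Qed.

(* By exactness of the averages, the direction used by the agents differs from
   the true gradient only through the disagreements of the two estimates. *)
Let direction_error k :
  enorm (g k - grad (global phi f) (X k)) <= L1 * s k + L3 * t k.
Proof.
have [trS trY] := tracking alpha x0 k A_ds.
have gE : g k = Gmap phi f (X k) (S k) +
    gradmx (stack_phi phi) (X k) *m dev (Y k).
  rewrite /g /Gmap -addrA; congr (_ + _).
  rewrite -mulmxDr; congr (_ *m _); rewrite /dev trY addrC.
  rewrite -[LHS](subrK (replicate (avg (stack_grad2 f (X k) (S k))))).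
  congr (_ + _); apply/mxcolP => i; rewrite !mxcolK; congr (_ *: _).
  by apply: eq_bigr => j _; rewrite mxcolK.
rewrite gE addrAC; apply: le_trans (enormD _ _) _; apply: lerD.
  rewrite grad_global// (le_trans (G_lip _ _ _ _))// subrr enorm0 add0r.
  by rewrite /s /dev trS.
exact: (gradmx_stack_phi_le _ _ _ (ltW L3_gt0) phi_bound).
Qed.

Let delta_le k : delta k <= alpha * (L1 * e k + L1 * s k + L3 * t k).
Proof.
rewrite /delta XS addrAC subrr add0r enormN enormZ gtr0_norm//.
rewrite ler_wpM2l ?(ltW alpha_gt0)//.
rewrite -[g k](subrK (grad (global phi f) (X k))) -[leRHS]addrA [leRHS]addrC.
apply: le_trans (enormD _ _) _; apply: lerD; first exact: direction_error.
by have := F_smooth (X k) xs; rewrite xs_crit subr0.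
Qed.

Let e_le k : e k.+1 <= (1 - alpha * mu) * e k + alpha * (L1 * s k + L3 * t k).
Proof.
pose D := grad (global phi f).
have -> : e k.+1 = enorm (((X k - alpha *: D (X k)) - (xs - alpha *: D xs)) -
    alpha *: (g k - D (X k))).
  rewrite /e XS /D xs_crit scaler0 subr0 scalerBr; congr enorm.
  by apply/colP => i; rewrite !mxE; ring.
apply: le_trans (enormB _ _) _; apply: lerD.
  exact: (gradient_step_contraction alpha_gt0 alphaL F_convex F_smooth).
by rewrite enormZ gtr0_norm// ler_wpM2l ?(ltW alpha_gt0)// direction_error.
Qed.

Let phi_step k :
  enorm (stack_phi phi (X k.+1) - stack_phi phi (X k)) <= L3 * delta k.
Proof. exact: (stack_phi_lipschitz _ _ _ (ltW L3_gt0) phi_bound). Qed.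

Let SS k : S k.+1 = mix A (S k) + (stack_phi phi (X k.+1) - stack_phi phi (X k)).
Proof. exact: stateS_step. Qed.

Let s_le k : s k.+1 <= rho * s k + L3 * delta k.
Proof.
rewrite /s SS devD; apply: le_trans (enormD _ _) _; apply: lerD.
  exact: enorm_dev_mix.
exact: le_trans (enorm_dev _ N_gt0) (phi_step k).
Qed.

Let S_step k : enorm (S k.+1 - S k) <= 2 * s k + L3 * delta k.
Proof.
rewrite SS addrAC; apply: le_trans (enormD _ _) _; apply: lerD => //.
exact: enorm_mix_sub.
Qed.

Let t_le k :
  t k.+1 <= rho * t k + L2 * (delta k + (2 * s k + L3 * delta k)).
Proof.
rewrite /t [Y k.+1](_ : _ = mix A (Y k) +
  (stack_grad2 f (X k.+1) (S k.+1) - stack_grad2 f (X k) (S k))); last first.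
  exact: stateY_step.
rewrite devD; apply: le_trans (enormD _ _) _; apply: lerD.
  exact: enorm_dev_mix.
apply: le_trans (enorm_dev _ N_gt0) _; apply: le_trans (grad2_lip _ _ _ _) _.
by rewrite ler_wpM2l// lerD2l S_step.
Qed.

Lemma dgt_linear_rate :
  rho < 1 ->
  alpha < mu * (1 - rho) ^+ 2 / (L3 * (mu + L1 + L1 * L3) *
        ((1 - rho) * (L1 + L2 + L2 * L3) + 2 * L2 * L3)) ->
  exists C q : R, [/\ 0 <= C, 0 < q < 1 &
    forall k, enorm (dgt_iterate phi f A alpha x0 k - xs) <= C * q ^+ k].
Proof.
move=> rho1 alphas.
by apply: (coupled_recursion_rate mu_gt0 L1_gt0 L2_ge0 L3_gt0 rho1 alpha_gt0
  alphas _ _ _ delta_le e_le s_le t_le) => k; exact: enorm_ge0.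
Qed.

End Errors.
End Tracking.

(** * Linear convergence *)

Theorem theorem1 (R : realType) (N : nat) (n : 'I_N -> nat) (d : nat)
    (E : rel 'I_N) (A : 'M[R]_N)
    (phi : forall i : 'I_N, 'cV[R]_(n i) -> 'cV[R]_d)
    (f : forall i : 'I_N, 'cV[R]_(n i) -> 'cV[R]_d -> R)
    (mu L1 L2 L3 alpha : R)
    (N_gt0 : (0 < N)%N)
    (A_comm : communication_matrix E A)
    (G1 : strongly_connected E)
    (G2 : doubly_stochastic A)
    (f_diff : forall (i : 'I_N) (u : 'cV[R]_(n i)) (s : 'cV[R]_d),
       differentiable (fun p : 'cV[R]_(n i) * 'cV[R]_d => f i p.1 p.2) (u, s))
    (F1_diff : forall x : stackX n, differentiable (global phi f) x)
    (mu_gt0 : 0 < mu)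
    (F1_convex : strongly_convex mu (global phi f))
    (F1_smooth : smooth L1 (global phi f))
    (F1_G : forall (x x' : stackX n) (y y' : stackY R N d),
       enorm (Gmap phi f x y - Gmap phi f x' y')
         <= L1 * (enorm (x - x') + enorm (y - y')))
    (F2 : forall (x x' : stackX n) (y y' : stackY R N d),
       enorm (stack_grad2 f x y - stack_grad2 f x' y')
         <= L2 * (enorm (x - x') + enorm (y - y')))
    (F3_diff : forall (i : 'I_N) (u : 'cV[R]_(n i)),
       differentiable (phi i) u)
    (L3_gt0 : 0 < L3)
    (F3_bound : forall (i : 'I_N) (u : 'cV[R]_(n i)),
       opnorm (gradmx (phi i) u) <= L3) :
  let rho := opnorm (A - avgmx) in
  let Lmu := mu + L1 + L1 * L3 in
  let L0 := L1 + L2 + L2 * L3 in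
  let alpha_s := mu * (1 - rho) ^+ 2
                 / (L3 * Lmu * ((1 - rho) * L0 + 2 * L2 * L3)) in
  0 < alpha < Num.min (1 / L1) alpha_s ->
  exists xstar : stackX n,
    unique (minimizer (global phi f)) xstar /\
    forall x0 : (forall i : 'I_N, 'cV[R]_(n i)),
      exists C q : R,
        [/\ 0 <= C, 0 < q < 1 &
            forall k : nat,
              enorm (dgt_iterate phi f A alpha x0 k - xstar) <= C * q ^+ k].
Proof.
move=> rho Lmu L0 alpha_s /andP[alpha_gt0]; rewrite lt_min => /andP[alt1 alts].
have L1_gt0 : 0 < L1.
  by have := lt_trans alpha_gt0 alt1; rewrite div1r invr_gt0.
have alphaL : alpha * L1 < 1 by rewrite -ltr_pdivlMr.
have A_ge0 i j : 0 <= A i j.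
  have [Epos Ezero] := A_comm i j.
  by case: (boolP (E j i)) => [/Epos/ltW | /Ezero ->].
(* rho <= 1 always holds, and rho = 1 would make alpha_s vanish *)
have rho1 : rho < 1.
  rewrite lt_neqAle opnorm_stochastic// andbT.
  apply: contraTneq (lt_trans alpha_gt0 alts) => rhoE.
  by rewrite /alpha_s rhoE subrr expr0n mulr0 mul0r ltxx.
have [xs [xs_crit xs_min]] :=
  minimizer_exists mu_gt0 alpha_gt0 alphaL F1_convex F1_smooth.
exists xs; split=> // x0.
(* when R^n has two distinct points, the Lipschitz bound on the second partial
   gradients forces L2 >= 0; otherwise there is nothing to estimate *)
have [[x [x' xx']]|all_eq] :=
    pselect (exists x x' : @stackX R N n, x <> x'); last first.
  exists 0, (1 / 2); split=> //.
    by rewrite divr_gt0//= ltr_pdivrMr// mul1r ltr1n.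
  move=> k; have -> : dgt_iterate phi f A alpha x0 k = xs.
    apply: contrapT => neq; apply: all_eq.
    by exists (dgt_iterate phi f A alpha x0 k), xs.
  by rewrite subrr enorm0 mul0r.
have L2_ge0 : 0 <= L2.
  have xx'_gt0 : 0 < enorm (x - x').
    rewrite lt_def enorm_ge0 andbT.
    by apply/eqP => /enorm_eq0 /subr0_eq; exact: xx'.
  have := le_trans (enorm_ge0 _) (F2 x x' 0 0).
  by rewrite subrr enorm0 addr0 pmulr_lge0.
exact: (dgt_linear_rate N_gt0 F3_diff f_diff x0 A_ge0 G2 mu_gt0 alpha_gt0 alphaL
  L1_gt0 L2_ge0 L3_gt0 F1_convex F1_smooth F1_G F2 F3_bound xs_crit rho1 alts).
Qed.
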